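(* Consider the problem $\min_{x\in\mathbb{R}^d}\{f(x): U(x)\ge0,\ Bx=b\}$, where $f$ is smooth, $U$ is concave, $B\in\mathbb{R}^{m\times d}$ with $\operatorname{rank}(B)=m<d$, and $b\in\mathbb{R}^m$. Let $\mathcal{M}=\{x\in\mathbb{R}^d: U(x)\ge0\}$ and let $h:\operatorname{int}(\mathcal{M})\to\mathbb{R}$ be a convex function of Legendre type with $\nabla^2h(x)$ positive definite for $x\in\operatorname{int}(\mathcal{M})$; equip $\mathcal{M}$ with the Hessian metric $$\langle v_1,v_2\rangle_{g(x)}=v_1\cdot\nabla^2h(x)v_2,\qquad v_1,v_2\in T_x\mathcal{M}\cong\mathbb{R}^d .$$ Let $n=d-m$ and let $\phi:\mathbb{R}^n\to\mathbb{R}^d$ be an affine map with $\{x: Bx=b\}=\{\phi(\theta):\theta\in\mathbb{R}^n\}$, whose Jacobian has the form $D_\theta\phi(\theta)=\begin{pmatrix}W\\ I\end{pmatrix}$ with $W\in\mathbb{R}^{m\times n}$ and $I$ the $n\times n$ identity, so that its columns form a basis of $\ker(B)$. Let $\Theta=\phi^{-1}(\mathcal{M})$. Suppose $\theta$ evolves (with $\phi(\theta)\in\operatorname{int}(\mathcal{M})$) according to $\dot\theta=p^{nat}$, where $p^{nat}$ is the natural gradient descent direction for $\min_{\theta\in\Theta}f(\phi(\theta))$, namely $$p^{nat}=-G(\theta)^{-1}\nabla_\theta f(\phi(\theta)),\qquad G_{ij}(\theta)=\langle\partial_{\theta_i}\phi(\theta),\partial_{\theta_j}\phi(\theta)\rangle_{g(\phi(\theta))},\quad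 1\le i,j\le n .$$ Then $x=\phi(\theta)$ satisfies the Hessian–Riemannian gradient descent equation $$\dot x=-P(x)\,\nabla^2h(x)^{-1}\nabla f(x),$$ where $P(x):\mathbb{R}^d\to\ker(B)$ is the $\nabla^2h(x)$-orthogonal projection onto $\ker(B)$.
   Context: $h:\operatorname{int}(\mathcal{M})\to\mathbb{R}$ is of Legendre type if $h\in C^2(\operatorname{int}(\mathcal{M}))$ is strictly convex and $|\nabla h(\xi_j)|\to+\infty$ for every sequence $(\xi_j)\subset\operatorname{int}(\mathcal{M})$ converging to a boundary point of $\mathcal{M}$. The $\nabla^2h(x)$-orthogonal projection is the orthogonal projection with respect to the inner product $(v_1,v_2)\mapsto v_1^\top\nabla^2h(x)v_2$. Dots denote time derivatives. *)

(* Defs.v *)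
From HB Require Import structures.
From mathcomp Require Import all_boot all_order all_algebra.
From mathcomp Require Import all_classical all_reals all_analysis.

Set Implicit Arguments.
Unset Strict Implicit.
Unset Printing Implicit Defensive.

Import Order.TTheory GRing.Theory Num.Theory.
Import numFieldNormedType.Exports.

Local Open Scope classical_set_scope.
Local Open Scope ring_scope.

(* Vectors of R^p are column vectors. The library topology on 'cV[R]_p comes
   from the max norm, i.e. it is the usual topology of R^p. A function defined
   only on an open set A is given as a total function, of which only the
   restriction to A is ever constrained. *)

Section Calculus.
Context {R : realType}.

Definition enorm p (v : 'cV[R]_p) : R := Num.sqrt (\sum_i v i 0 ^+ 2).

Definition partial p (W : normedModType R) (i : 'I_p) (f : 'cV[R]_p -> W)
    (x : 'cV[R]_p) : W :=
  'D_(delta_mx i 0) f x.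

Definition grad p (f : 'cV[R]_p -> R) (x : 'cV[R]_p) : 'cV[R]_p :=
  \col_i partial i f x.

Definition hess p (f : 'cV[R]_p -> R) (x : 'cV[R]_p) : 'M[R]_p :=
  \matrix_(i, j) partial i (partial j f) x.

Definition jac p q (F : 'cV[R]_p -> 'cV[R]_q) (x : 'cV[R]_p) : 'M[R]_(q, p) :=
  \matrix_(i, j) partial j F x i 0.

(* C^k on an open set A, by iterated Frechet differentiability *)
Fixpoint Ck p (A : set 'cV[R]_p) (k : nat) (f : 'cV[R]_p -> R) : Prop :=
  match k with
  | 0%N => forall x, A x -> {for x, continuous f}
  | k'.+1 => (forall x, A x -> differentiable f x) /\
             (forall i, Ck A k' (partial i f))
  end.

Definition smooth p (f : 'cV[R]_p -> R) : Prop := forall k, Ck setT k f.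

Definition concave p (f : 'cV[R]_p -> R) : Prop :=
  @convex_function R 'cV[R]_p setT (fun x => - f x).

Definition strictly_convex_on p (A : set 'cV[R]_p) (f : 'cV[R]_p -> R) : Prop :=
  forall x y (t : R), A x -> A y -> x != y -> 0 < t -> t < 1 ->
    f (t *: x + (1 - t) *: y) < t * f x + (1 - t) * f y.

Definition is_affine p q (F : 'cV[R]_p -> 'cV[R]_q) : Prop :=
  exists (A : 'M[R]_(q, p)) (c : 'cV[R]_q), forall x, F x = A *m x + c.

Definition boundary p (A : set 'cV[R]_p) : set 'cV[R]_p :=
  closure A `\` interior A.

Definition legendre_type p (M : set 'cV[R]_p) (h : 'cV[R]_p -> R) : Prop :=
  [/\ Ck (interior M) 2 h,
      strictly_convex_on (interior M) h &
      forall (xi : nat -> 'cV[R]_p) (x : 'cV[R]_p),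
        (forall j, interior M (xi j)) -> boundary M x ->
        xi j @[j --> \oo] --> x ->
        enorm (grad h (xi j)) @[j --> \oo] --> +oo].

End Calculus.

Section Geometry.
Context {R : realType}.

Definition bform p (A : 'M[R]_p) (u v : 'cV[R]_p) : R := (u^T *m (A *m v)) 0 0.

Definition posdef p (A : 'M[R]_p) : Prop := forall v, v != 0 -> 0 < bform A v v.

Definition hmetric p (h : 'cV[R]_p -> R) (x v1 v2 : 'cV[R]_p) : R :=
  bform (hess h x) v1 v2.

(* P is the matrix of the A-orthogonal projection onto ker(B): Pv lies in
   ker(B) and v - Pv is A-orthogonal to ker(B) *)
Definition is_orth_proj q p (A : 'M[R]_p) (B : 'M[R]_(q, p)) (P : 'M[R]_p) :
    Prop :=
  forall v : 'cV[R]_p,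
    B *m (P *m v) = 0 /\
    (forall w : 'cV[R]_p, B *m w = 0 -> bform A w (v - P *m v) = 0).

(* exists and is unique as soon as A is positive definite *)
Definition orth_proj q p (A : 'M[R]_p) (B : 'M[R]_(q, p)) : 'M[R]_p :=
  xget 0 [set P | is_orth_proj A B P].

Definition gram p n (h : 'cV[R]_p -> R) (phi : 'cV[R]_n -> 'cV[R]_p)
    (theta : 'cV[R]_n) : 'M[R]_n :=
  \matrix_(i, j) hmetric h (phi theta) (partial i phi theta)
                                       (partial j phi theta).

Definition natgrad_dir p n (h f : 'cV[R]_p -> R) (phi : 'cV[R]_n -> 'cV[R]_p)
    (theta : 'cV[R]_n) : 'cV[R]_n :=
  - (invmx (gram h phi theta) *m grad (fun s => f (phi s)) theta).

End Geometry.

(* Main.v *)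
(* Let E be the constant Jacobian of phi, H the Hessian of h, and G = E^T H E
   the Gram matrix.  Since ker B is the range of E, the H-orthogonal projection
   onto ker B is P = E G^-1 E^T H.  By the chain rule the gradient of f o phi is
   E^T grad f, so
   x' = E theta' = - E G^-1 E^T grad f = - P H^-1 grad f. *)

Require Import Defs.
From HB Require Import structures.
From mathcomp Require Import all_boot all_order all_algebra.
From mathcomp Require Import all_classical all_reals all_analysis.

Set Implicit Arguments.
Unset Strict Implicit.
Unset Printing Implicit Defensive.

Import Order.TTheory GRing.Theory Num.Theory.
Import numFieldNormedType.Exports.

Local Open Scope classical_set_scope.
Local Open Scope ring_scope.

(** Reduces matrix-valued derivatives to scalar ones, where the rules for sums and multiples
    apply. *)
Lemma is_derive_mxP (R : realType) (V : normedModType R) p q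
  (F : V -> 'M[R]_(p, q)) (dF : 'M[R]_(p, q)) (a v : V) :
  is_derive a v F dF <-> forall i j, is_derive a v (fun s => F s i j) (dF i j).
Proof.
split=> [[/[dup] Fd /derivable_mxP dFij <-] i j | dFij].
  by apply: DeriveDef => //; rewrite derive_mx // mxE.
have Fd : derivable F a v by apply/derivable_mxP => i j; case: (dFij i j).
apply: DeriveDef => //; rewrite derive_mx //.
by apply/matrixP => i j; rewrite mxE; case: (dFij i j).
Qed.

Lemma is_derive_affine (R : realType) (V : normedModType R) p q
  (A : 'M[R]_(q, p)) (c : 'cV[R]_q) (F : V -> 'cV[R]_p) (dF : 'cV[R]_p)
  (a v : V) :
  is_derive a v F dF -> is_derive a v (fun s => A *m F s + c) (A *m dF).
Proof.
move=> /is_derive_mxP dFij; apply/is_derive_mxP => i j.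
(* As a sum of functions, the entry has a shape from which its derivative is inferred by instance
   resolution. *)
have -> : (fun s => (A *m F s + c) i j) =
    \sum_k (A i k \*: (fun s => F s k j)) + cst (c i j).
  apply/funext => s; rewrite !mxE fctE fct_sumE /=.
  by congr (_ + _); apply: eq_bigr.
apply: is_derive_eq; rewrite addr0 mxE.
by apply: eq_bigr.
Qed.

(** Differentiability makes ['D_v f x] linear in [v], so [v] can be expanded in the standard
    basis. *)
Lemma derive_grad (R : realType) p (f : 'cV[R]_p -> R) (x v : 'cV[R]_p) :
  differentiable f x -> 'D_v f x = ((grad f x)^T *m v) 0 0.
Proof.
move=> fx; rewrite deriveE // {1}(_ : v = \sum_i v i 0 *: delta_mx i 0).
  rewrite linear_sum mxE; apply: eq_bigr => i _.
  by rewrite linearZ !mxE /partial deriveE // mulrC.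
rewrite {1}[v]matrix_sum_delta; apply: eq_bigr => i _.
by rewrite big_ord1.
Qed.

(** The two difference quotients are the same function of the increment, so their limits agree. *)
Lemma derive_comp_affine (R : realType) (W : normedModType R) p q
  (A : 'M[R]_(q, p)) (c : 'cV[R]_q) (f : 'cV[R]_q -> W) (s v : 'cV[R]_p) :
  'D_v (fun r => f (A *m r + c)) s = 'D_(A *m v) f (A *m s + c).
Proof.
rewrite /derive; congr (lim (_ @ 0^')); apply/funext => e /=.
by rewrite mulmxDr -scalemxAr addrA.
Qed.

Lemma grad_comp_affine (R : realType) p q (A : 'M[R]_(q, p)) (c : 'cV[R]_q)
  (f : 'cV[R]_q -> R) (s : 'cV[R]_p) : differentiable f (A *m s + c) ->
  grad (fun r => f (A *m r + c)) s = A^T *m grad f (A *m s + c).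
Proof.
move=> fd; apply/colP => i; rewrite mxE /partial derive_comp_affine.
rewrite derive_grad // mulmxA -colE !mxE.
by apply: eq_bigr => k _; rewrite !mxE mulrC.
Qed.

Lemma jac_affine (R : realType) p q (A : 'M[R]_(q, p)) (c : 'cV[R]_q)
  (s : 'cV[R]_p) : jac (fun r => A *m r + c) s = A.
Proof.
apply/matrixP => i j; rewrite mxE /partial.
have [_ ->] := is_derive_affine A c (is_derive_id s (delta_mx j 0)).
by rewrite -colE mxE.
Qed.

Lemma gram_affine (R : realType) p q (A : 'M[R]_(q, p)) (c : 'cV[R]_q)
  (h : 'cV[R]_q -> R) (s : 'cV[R]_p) :
  gram h (fun r => A *m r + c) s = A^T *m hess h (A *m s + c) *m A.
Proof.
have dA i : partial i (fun r => A *m r + c) s = col i A.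
  rewrite /partial colE.
  by have [_ ->] := is_derive_affine A c (is_derive_id s (delta_mx i 0)).
apply/matrixP => i j; rewrite mxE /hmetric /bform !dA.
rewrite mulmxA tr_col -!row_mul colE mulmxA -colE !mxE.
by apply: eq_bigr => k _; rewrite !mxE.
Qed.

Lemma ker_trivial_unitmx (R : fieldType) p (A : 'M[R]_p) :
  (forall v : 'cV_p, A *m v = 0 -> v = 0) -> A \in unitmx.
Proof.
(* [kermx] is a left kernel, hence the passage to [A^T]: the rows of its kernel, transposed, are
   vectors killed by [A]. *)
move=> A0; rewrite -unitmx_tr -row_free_unit -kermx_eq0.
apply/eqP/row_matrixP => i; rewrite row0; apply: trmx_inj; rewrite trmx0.
apply: A0; apply: trmx_inj.
by rewrite trmx_mul trmxK -row_mul mulmx_ker row0 trmx0.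
Qed.

Lemma posdef_unitmx (R : realType) p (A : 'M[R]_p) : posdef A -> A \in unitmx.
Proof.
move=> Apos; apply: ker_trivial_unitmx => v Av; apply/eqP/negPn/negP => /Apos.
by rewrite /bform Av mulmx0 mxE ltxx.
Qed.

Lemma posdef_congr (R : realType) p q (A : 'M[R]_q) (E : 'M[R]_(q, p)) :
  (forall v : 'cV_p, E *m v = 0 -> v = 0) -> posdef A -> posdef (E^T *m A *m E).
Proof.
move=> Einj Apos v v0.
have -> : bform (E^T *m A *m E) v v = bform A (E *m v) (E *m v).
  by rewrite /bform trmx_mul !mulmxA.
by apply: Apos; apply: contra_neq v0; exact: Einj.
Qed.

Lemma bformBr (R : realType) p (A : 'M[R]_p) (u v w : 'cV[R]_p) :
  bform A u (v - w) = bform A u v - bform A u w.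
Proof. by rewrite /bform !mulmxBr [LHS]mxE [X in _ + X]mxE. Qed.

(** The vector [P *m v - Q *m v] lies in the kernel of [B] and is also [A]-orthogonal to it, hence
    to itself; positivity forces it to vanish. *)
Lemma is_orth_proj_uniq (R : realType) q p (A : 'M[R]_p) (B : 'M[R]_(q, p))
  (P Q : 'M[R]_p) :
  posdef A -> is_orth_proj A B P -> is_orth_proj A B Q -> P = Q.
Proof.
move=> Apos projP projQ; apply/matrixP => i j.
suff PQ (v : 'cV_p) : P *m v = Q *m v.
  by have /colP/(_ i) := PQ (delta_mx j 0); rewrite -!colE !mxE.
have [BP oP] := projP v; have [BQ oQ] := projQ v.
apply/eqP; rewrite -subr_eq0; apply/negPn/negP => /Apos.
have Bw : B *m (P *m v - Q *m v) = 0 by rewrite mulmxBr BP BQ subr0.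
have PQE : P *m v - Q *m v = (v - Q *m v) - (v - P *m v).
  by rewrite opprB [RHS]addrC subrKA.
by rewrite {2}PQE bformBr oP // oQ // subrr ltxx.
Qed.

Lemma orth_projE (R : realType) q p (A : 'M[R]_p) (B : 'M[R]_(q, p))
  (P : 'M[R]_p) : posdef A -> is_orth_proj A B P -> orth_proj A B = P.
Proof.
move=> Apos projP; apply: (is_orth_proj_uniq Apos _ projP).
exact: (xgetI 0 projP).
Qed.

(** Weighted least squares: for this matrix [P], the Gram factor cancels in [E^T *m A *m P], leaving
    [E^T *m A]. So the residual [v - P *m v] is [A]-orthogonal to the range of [E], which is the
    kernel of [B]. *)
Lemma is_orth_proj_range (R : realType) q p n (A : 'M[R]_p) (B : 'M[R]_(q, p))
  (E : 'M[R]_(p, n)) :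
  B *m E = 0 -> (forall w : 'cV_p, B *m w = 0 -> exists u : 'cV_n, w = E *m u) ->
  E^T *m A *m E \in unitmx ->
  is_orth_proj A B (E *m (invmx (E^T *m A *m E) *m (E^T *m A))).
Proof.
move=> BE kerB Gunit v; split=> [|w /kerB[u ->]].
  by rewrite !mulmxA BE !mul0mx.
have EAP : E^T *m A *m (E *m (invmx (E^T *m A *m E) *m (E^T *m A))) = E^T *m A.
  by rewrite mulmxA mulKVmx.
by rewrite /bform trmx_mul mulmxA -2!(mulmxA u^T) mulmxBr mulmxA EAP subrr mulmx0
  mxE.
Qed.

Theorem lemma4p2 (R : realType) (m n : nat) (n_gt0 : (0 < n)%N)
  (f U : 'cV[R]_(m + n) -> R) (B : 'M[R]_(m, m + n)) (b : 'cV[R]_m)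
  (f_smooth : smooth f) (U_concave : concave U) (B_rank : \rank B = m)
  (M : set 'cV[R]_(m + n)) (M_def : M = [set x | 0 <= U x])
  (h : 'cV[R]_(m + n) -> R) (h_legendre : legendre_type M h)
  (h_posdef : forall x : 'cV[R]_(m + n), interior M x -> posdef (hess h x))
  (phi : 'cV[R]_n -> 'cV[R]_(m + n)) (phi_affine : is_affine phi)
  (phi_onto : [set x | B *m x = b] = range phi)
  (W : 'M[R]_(m, n)) (phi_jac : forall s, jac phi s = col_mx W 1%:M)
  (J : set R) (theta : R -> 'cV[R]_n)
  (theta_int : forall t, J t -> interior M (phi (theta t)))
  (theta_flow : forall t, J t ->
     is_derive t 1 theta (natgrad_dir h f phi (theta t))) :
  let x := fun t => phi (theta t) in
  forall t, J t ->
    is_derive t 1 x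
      (- (orth_proj (hess h (x t)) B *m
          (invmx (hess h (x t)) *m grad f (x t)))).
Proof.
move=> x t Jt.
have [E [c phiE]] := phi_affine.
have {phiE phi_affine}phiE : phi = fun s => E *m s + c by apply/funext.
(* The Jacobian is constant, so the base point 0 is arbitrary. The identity block then makes [E]
   injective. *)
have EW : E = col_mx W 1%:M by rewrite -(phi_jac 0) phiE jac_affine.
have Einj (v : 'cV_n) : E *m v = 0 -> v = 0.
  rewrite EW mul_col_mx mul1mx -[0 in X in X -> _]col_mx0.
  by move=> /eq_col_mx[].
have Bphi s : B *m (E *m s + c) = b.
  have : range phi (phi s) by exists s.
  by rewrite -phi_onto phiE.
have Bc : B *m c = b by have := Bphi 0; rewrite mulmx0 add0r.
have BE : B *m E = 0.
  apply/matrixP => i j; have := Bphi (delta_mx j 0).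
  rewrite mulmxDr Bc => /eqP; rewrite -subr_eq0 addrK mulmxA -colE => /eqP.
  by move=> /colP/(_ i); rewrite !mxE.
(* Translating [w] by the feasible point [c] gives a solution of the constraint, hence a value of
   [phi]; cancelling [c] yields [u]. *)
have kerB (w : 'cV_(m + n)) : B *m w = 0 -> exists u : 'cV_n, w = E *m u.
  move=> Bw; have : [set x | B *m x = b] (w + c) by rewrite /= mulmxDr Bw add0r.
  by rewrite phi_onto phiE => -[u _ /addIr <-]; exists u.
have xt : x t = E *m theta t + c by rewrite /x phiE.
have Hpos : posdef (hess h (x t)) by apply/h_posdef/theta_int.
(* Guarantees that [invmx] of the Gram matrix is a true inverse, since [invmx] returns a singular
   matrix unchanged. *)
have Gunit := posdef_unitmx (posdef_congr Einj Hpos).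
have projP := is_orth_proj_range BE kerB Gunit.
have fd : differentiable f (E *m theta t + c).
  by case: (f_smooth 1%N) => + _; apply.
rewrite (orth_projE Hpos projP).
have := is_derive_affine E c (theta_flow t Jt).
rewrite /natgrad_dir phiE gram_affine grad_comp_affine // -xt.
have -> : (fun s => E *m theta s + c) = x by rewrite /x phiE.
(* The Hessian ending the projection formula cancels against its inverse in front of [grad f]. *)
rewrite mulmxN -!mulmxA mulKVmx //; exact: posdef_unitmx.
Qed.
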